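(* Let $\alpha\in\mathbb{R}$. The function $x\mapsto \dfrac{[\Gamma(x+1)]^{1/x}}{(x+1)^\alpha}$ is logarithmically completely monotonic on $(-1,\infty)$ if and only if $\alpha\ge 1$.
   Context: A positive function $f$ on an interval $I$ is called logarithmically completely monotonic on $I$ if it has derivatives of all orders on $I$ and $(-1)^n[\ln f(x)]^{(n)}\ge 0$ for all $x\in I$ and all $n\in\mathbb{N}=\{1,2,\dots\}$. $\Gamma$ is the Euler gamma function. Convention: at $x=0$ the expression $[\Gamma(x+1)]^{1/x}$ is assigned its limiting value $e^{-\gamma}$, where $\gamma$ is the Euler–Mascheroni constant. *)

(* Defs.v *)
(* World: Stdlib reals with Coquelicot. *)
From Stdlib Require Import Reals.
From Coquelicot Require Import Coquelicot.
Open Scope R_scope.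

(* Euler's integral of the second kind, improper at both ends; it converges
   exactly for x > 0, and [Gamma] is meaningful only there. *)
Definition Gamma (x : R) : R :=
  RInt_gen (fun t : R => Rpower t (x - 1) * exp (- t))
           (at_right 0) (Rbar_locally p_infty).

(* The Euler-Mascheroni constant. *)
Definition euler_gamma : R :=
  real (Lim_seq (fun n : nat => sum_n_m (fun k : nat => / INR k) 1 n - ln (INR n))).

(* [Gamma (x + 1)] to the power [1 / x], extended at [x = 0] by its limit. *)
Definition Gamma_root (x : R) : R :=
  if Req_EM_T x 0 then exp (- euler_gamma) else Rpower (Gamma (x + 1)) (1 / x).

(* Stated for the open interval (a, b), whose ends may be infinite, so that
   the two-sided derivatives of Coquelicot are the derivatives on the interval.
   [Derive_n] is total: the separate [ex_derive_n] clause is what asserts that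
   the derivatives exist. As [f] is positive, it makes [ln f] smooth too. *)
Definition log_completely_monotonic (a b : Rbar) (f : R -> R) : Prop :=
  (forall x : R, Rbar_lt a x -> Rbar_lt x b -> 0 < f x) /\
  (forall (n : nat) (x : R), Rbar_lt a x -> Rbar_lt x b -> ex_derive_n f n x) /\
  (forall (n : nat) (x : R), (1 <= n)%nat -> Rbar_lt a x -> Rbar_lt x b ->
     0 <= (-1) ^ n * Derive_n (fun t : R => ln (f t)) n x).

(* Main.v *)
(* Binet's form of log Gamma does everything: for x > -1,
     ln Gamma(x + 1) = x (ln(x + 1) - 1 + B(x)),
     B(x) = int_1^oo {y} / (y (y + x)) dy,  {y} the fractional part of y.
   At x = 0 one has B(0) = 1 - gamma, so the logarithm of the function of the
   theorem is B(x) - 1 + (1 - alpha) ln(x + 1) throughout (-1, oo).  Differentiating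
   under the integral sign makes B completely monotonic, and so is
   the derivative 1 / (x + 1) of ln(x + 1), which settles alpha >= 1.  If
   alpha < 1, the logarithm is unbounded above since B >= 0, hence not decreasing.
   The integral over [k, k + 1] is elementary and its partial sums telescope against
   Gamma(x + 1) = x Gamma(x); the limit comes from Wendel's inequality, itself the
   integral of the tangent inequality for the concave function t^s. *)

Require Import Defs.
From Stdlib Require Import Reals Factorial Lra Lia.
From Coquelicot Require Import Coquelicot.
Open Scope R_scope.

(** * The Gamma integral *)

Lemma is_derive_Rpower (s t : R) : 0 < t ->
  is_derive (fun u => Rpower u s) t (s * Rpower t (s - 1)).
Proof.
  intros Ht. apply is_derive_Reals. now apply derivable_pt_lim_power.
Qed.

Lemma Rpower_pos (t s : R) : 0 < Rpower t s.
Proof. apply exp_pos. Qed.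

Lemma at_right_gt (a : R) : at_right a (fun t => a < t).
Proof. exists (mkposreal _ Rlt_0_1). now intros. Qed.

Lemma filter_prod_half_line (P : R -> Prop) :
  (forall t, 0 < t -> P t) ->
  filter_prod (at_right 0) (Rbar_locally p_infty)
    (fun ab => forall t, Rmin (fst ab) (snd ab) <= t <= Rmax (fst ab) (snd ab) -> P t).
Proof.
  intros HP. exists (fun t => 0 < t) (fun t => 0 < t).
  - apply at_right_gt.
  - now exists 0.
  - intros a b Ha Hb t [Ht _]. apply HP. simpl in Ht.
    apply Rlt_le_trans with (2 := Ht). now apply Rmin_glb_lt.
Qed.

Lemma is_RInt_gen_ext_half_line (f g : R -> R) (l : R) :
  (forall t, 0 < t -> f t = g t) ->
  is_RInt_gen f (at_right 0) (Rbar_locally p_infty) l ->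
  is_RInt_gen g (at_right 0) (Rbar_locally p_infty) l.
Proof.
  intros Hfg. apply is_RInt_gen_ext.
  apply filter_imp with (2 := filter_prod_half_line _ Hfg).
  intros ab H t Ht. apply H. lra.
Qed.

Lemma is_RInt_gen_nonneg (f : R -> R) (l : R) :
  (forall t, 0 < t -> 0 <= f t) ->
  is_RInt_gen f (at_right 0) (Rbar_locally p_infty) l -> 0 <= l.
Proof.
  intros Hf Hl.
  cut (norm l <= l).
  { change (norm l) with (Rabs l). intros H. generalize (Rabs_pos l). lra. }
  apply (@RInt_gen_norm R_CompleteNormedModule (at_right 0) (Rbar_locally p_infty) _ _
           f f l l); trivial.
  - exists (fun t => t < 1) (fun t => 1 < t).
    + exists (mkposreal _ Rlt_0_1). intros y Hy _.
      apply Rabs_def2 in Hy. unfold minus, plus, opp in Hy; simpl in Hy. lra.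
    + now exists 1.
    + intros a b Ha Hb; simpl; lra.
  - apply filter_imp with (2 := filter_prod_half_line _ Hf).
    intros ab H t Ht. change (norm (f t)) with (Rabs (f t)).
    rewrite Rabs_pos_eq; [lra|]. apply H.
    generalize (Rmin_l (fst ab) (snd ab)) (Rmax_r (fst ab) (snd ab)). lra.
Qed.

Lemma is_RInt_gen_le (f g : R -> R) (lf lg : R) :
  (forall t, 0 < t -> f t <= g t) ->
  is_RInt_gen f (at_right 0) (Rbar_locally p_infty) lf ->
  is_RInt_gen g (at_right 0) (Rbar_locally p_infty) lg -> lf <= lg.
Proof.
  intros Hfg Hf Hg. apply Rminus_le_0.
  apply is_RInt_gen_nonneg with (fun t => minus (g t) (f t)).
  - intros t Ht. specialize (Hfg t Ht). unfold minus, plus, opp; simpl. lra.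
  - apply (is_RInt_gen_minus g f lg lf Hg Hf).
Qed.

Lemma ex_RInt_half_line (f : R -> R) (a b : R) :
  (forall t, 0 < t -> continuous f t) -> 0 < a -> 0 < b -> ex_RInt f a b.
Proof.
  intros Hf Ha Hb. apply (ex_RInt_continuous (V := R_CompleteNormedModule)).
  intros t [Ht _]. apply Hf. apply Rlt_le_trans with (2 := Ht). now apply Rmin_glb_lt.
Qed.

Lemma ex_RInt_gen_bounded (f : R -> R) (M : R) :
  (forall t, 0 < t -> continuous f t) ->
  (forall t, 0 < t -> 0 <= f t) ->
  (forall a b, 0 < a -> a <= b -> RInt f a b <= M) ->
  ex_RInt_gen f (at_right 0) (Rbar_locally p_infty).
Proof.
  intros Hc Hp HM.
  destruct (completeness (fun y => exists a b, 0 < a /\ a <= b /\ y = RInt f a b))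
    as [l [Hub Hlub]].
  - exists M. intros y (a & b & Ha & Hab & ->). now apply HM.
  - exists (RInt f 1 1), 1, 1. repeat split; lra.
  - exists l. intros P [eps HP].
    assert (exists a0 b0, 0 < a0 /\ a0 <= b0 /\ l - eps < RInt f a0 b0)
      as (a0 & b0 & Ha0 & Hab0 & H0).
    { apply Classical_Prop.NNPP. intros Hn.
      assert (l <= l - eps).
      { apply Hlub. intros y (a & b & Ha & Hab & ->).
        apply Rnot_lt_le. intros H. apply Hn. now exists a, b. }
      generalize (cond_pos eps). lra. }
    exists (fun t => 0 < t < a0) (fun t => b0 < t).
    + exists (mkposreal _ Ha0). intros y Hy Hy0. split; trivial.
      apply Rabs_def2 in Hy. unfold minus, plus, opp in Hy; simpl in Hy. lra.
    + now exists b0.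
    + intros a b [Ha Haa] Hb. exists (RInt f a b). split; simpl.
      * apply (RInt_correct (V := R_CompleteNormedModule)).
        apply ex_RInt_half_line; trivial; lra.
      * apply HP.
        assert (RInt f a b <= l) by (apply Hub; exists a, b; repeat split; lra).
        assert (Hpos : forall c d, 0 < c -> c <= d -> 0 <= RInt f c d).
        { intros c d H1 H2. apply RInt_ge_0; trivial.
          apply ex_RInt_half_line; trivial; lra.
          intros t Ht. apply Hp; lra. }
        assert (RInt f a b = RInt f a a0 + (RInt f a0 b0 + RInt f b0 b)) as E.
        { rewrite <- (RInt_Chasles f a a0 b) by (apply ex_RInt_half_line; trivial; lra).
          rewrite <- (RInt_Chasles f a0 b0 b) by (apply ex_RInt_half_line; trivial; lra).
          reflexivity. }
        assert (H1 := Hpos a a0 Ha (Rlt_le _ _ Haa)).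
        assert (H2 : 0 <= RInt f b0 b) by (apply Hpos; lra).
        change (Rabs (RInt f a b - l) < eps).
        apply Rabs_def1; generalize (cond_pos eps); lra.
Qed.

Lemma is_RInt_gen_derive_half_line (F f : R -> R) (la lb : R) :
  (forall t, 0 < t -> is_derive F t (f t)) ->
  (forall t, 0 < t -> continuous f t) ->
  filterlim F (at_right 0) (locally la) ->
  filterlim F (Rbar_locally p_infty) (locally lb) ->
  is_RInt_gen f (at_right 0) (Rbar_locally p_infty) (lb - la).
Proof.
  intros HF Hf Ha Hb.
  apply is_RInt_gen_ext_half_line with (Derive F).
  { intros t Ht. now apply is_derive_unique, HF. }
  apply is_RInt_gen_Derive; trivial.
  - apply filter_prod_half_line. intros t Ht. exists (f t). now apply HF.
  - apply filter_prod_half_line. intros t Ht.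
    apply continuous_ext_loc with (2 := Hf t Ht).
    exists (mkposreal t Ht). intros y Hy. symmetry. apply is_derive_unique, HF.
    apply Rabs_def2 in Hy. unfold minus, plus, opp in Hy; simpl in Hy. lra.
Qed.

Lemma ln_le_sub (t : R) : 0 < t -> ln t <= t - 1.
Proof.
  intros Ht. generalize (exp_ineq1_le (ln t)). rewrite exp_ln by easy. lra.
Qed.

Lemma ln_ge_sub (t : R) : 0 < t -> 1 - / t <= ln t.
Proof.
  intros Ht. generalize (ln_le_sub (/ t) (Rinv_0_lt_compat _ Ht)).
  rewrite ln_Rinv by easy. lra.
Qed.

Lemma Rpower_exp_vanish_right (x : R) : 0 < x ->
  filterlim (fun t => Rpower t x * exp (- t)) (at_right 0) (locally 0).
Proof.
  intros Hx. apply filterlim_locally. intros eps.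
  assert (Hd : 0 < Rpower eps (/ x)) by apply Rpower_pos.
  exists (mkposreal _ Hd). intros t Ht Ht0.
  apply Rabs_def2 in Ht. unfold minus, plus, opp in Ht; simpl in Ht.
  change (Rabs (Rpower t x * exp (- t) - 0) < eps). rewrite Rminus_0_r.
  rewrite Rabs_pos_eq
    by (apply Rmult_le_pos; apply Rlt_le; [apply Rpower_pos | apply exp_pos]).
  apply Rle_lt_trans with (Rpower t x * 1).
  - apply Rmult_le_compat_l; [apply Rlt_le, Rpower_pos|].
    rewrite <- exp_0. apply Rlt_le, exp_increasing. lra.
  - rewrite Rmult_1_r.
    replace (pos eps) with (Rpower (Rpower eps (/ x)) x).
    + apply Rlt_Rpower_l; lra.
    + rewrite Rpower_mult, Rinv_l by lra. apply Rpower_1, cond_pos.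
Qed.

Lemma Rpower_exp_vanish_p_infty (x : R) : 0 < x ->
  filterlim (fun t => Rpower t x * exp (- t)) (Rbar_locally p_infty) (locally 0).
Proof.
  intros Hx. apply filterlim_locally. intros eps.
  set (C := (x + 1) * ln (x + 1)).
  exists (exp C / eps). intros t Ht.
  assert (Heps := cond_pos eps).
  assert (Ht0 : 0 < t).
  { apply Rlt_trans with (2 := Ht). apply Rdiv_lt_0_compat; trivial. apply exp_pos. }
  change (Rabs (Rpower t x * exp (- t) - 0) < eps). rewrite Rminus_0_r.
  rewrite Rabs_pos_eq
    by (apply Rmult_le_pos; apply Rlt_le; [apply Rpower_pos | apply exp_pos]).
  apply Rle_lt_trans with (exp C / t).
  - apply Rmult_le_reg_l with t; trivial.
    replace (t * (exp C / t)) with (exp C) by (field; lra).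
    unfold Rpower. rewrite <- (exp_ln t) at 1 by easy. rewrite <- !exp_plus.
    assert (H : (x + 1) * ln (t / (x + 1)) <= (x + 1) * (t / (x + 1) - 1)).
    { apply Rmult_le_compat_l; [lra|]. apply ln_le_sub. apply Rdiv_lt_0_compat; lra. }
    unfold Rdiv in H. rewrite ln_mult, ln_Rinv in H
      by (try apply Rinv_0_lt_compat; lra).
    replace ((x + 1) * (t * / (x + 1) - 1)) with (t - (x + 1)) in H by (field; lra).
    destruct (Rle_lt_or_eq_dec (ln t + (x * ln t + - t)) C) as [H1|H1].
    + unfold C. lra.
    + apply Rlt_le, exp_increasing, H1.
    + rewrite H1. apply Rle_refl.
  - apply Rmult_lt_reg_l with t; trivial.
    replace (t * (exp C / t)) with (exp C / eps * eps) by (field; lra).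
    now apply Rmult_lt_compat_r.
Qed.

(* The tangent line of the concave function [t ^ s] at [t = c]. *)
Lemma Rpower_tangent (c s t : R) : 0 < c -> 0 < t -> 0 <= s <= 1 ->
  Rpower t s <= Rpower c s * (1 - s + s / c * t).
Proof.
  intros Hc Ht Hs.
  assert (Hu : 0 < t / c) by (now apply Rdiv_lt_0_compat).
  replace (Rpower t s) with (Rpower c s * Rpower (t / c) s).
  2:{ rewrite Rpower_mult_distr by trivial. f_equal. field. lra. }
  apply Rmult_le_compat_l; [apply Rlt_le, Rpower_pos|].
  replace (s / c * t) with (s * (t / c)) by (field; lra).
  set (u := t / c) in *. set (v := 1 - s + s * u).
  assert (Hv : 0 < v).
  { unfold v. destruct (Rle_lt_or_eq_dec 0 s (proj1 Hs)) as [H|<-]; [|lra].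
    assert (0 < s * u) by now apply Rmult_lt_0_compat. lra. }
  (* Concavity of [ln] at the points [1] and [u] with barycentre [v]. *)
  assert (H1 := ln_le_sub (/ v) (Rinv_0_lt_compat _ Hv)).
  assert (H2 := ln_le_sub (u / v) (Rdiv_lt_0_compat _ _ Hu Hv)).
  unfold Rdiv in H2. rewrite ln_mult, ln_Rinv in H2
    by (try apply Rinv_0_lt_compat; lra).
  rewrite ln_Rinv in H1 by lra.
  assert (H : (1 - s) * (- ln v) + s * (ln u + - ln v) <=
              (1 - s) * (/ v - 1) + s * (u * / v - 1)).
  { apply Rplus_le_compat; apply Rmult_le_compat_l; lra. }
  replace ((1 - s) * (/ v - 1) + s * (u * / v - 1)) with 0 in H
    by (unfold v in *; field; lra).
  unfold Rpower. rewrite <- (exp_ln v) by easy.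
  destruct (Rle_lt_or_eq_dec (s * ln u) (ln v)) as [H3|H3]; [lra| |].
  - apply Rlt_le, exp_increasing, H3.
  - rewrite H3. apply Rle_refl.
Qed.

Definition gamma_integrand (x t : R) : R := Rpower t (x - 1) * exp (- t).

Lemma gamma_integrand_pos (x t : R) : 0 < gamma_integrand x t.
Proof. apply Rmult_lt_0_compat; apply exp_pos. Qed.

Lemma gamma_integrand_plus (x s t : R) :
  gamma_integrand (x + s) t = Rpower t s * gamma_integrand x t.
Proof.
  unfold gamma_integrand. rewrite <- Rmult_assoc, <- Rpower_plus.
  do 2 f_equal. ring.
Qed.

Lemma gamma_integrand_S (x t : R) : 0 < t ->
  gamma_integrand (x + 1) t = t * gamma_integrand x t.
Proof. intros Ht. rewrite gamma_integrand_plus, Rpower_1; trivial. Qed.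

Lemma continuous_gamma_integrand (x t : R) : 0 < t -> continuous (gamma_integrand x) t.
Proof.
  intros Ht. apply (continuous_mult (K := R_AbsRing)).
  - apply (ex_derive_continuous (V := R_NormedModule)). eexists.
    now apply is_derive_Rpower.
  - apply (ex_derive_continuous (V := R_NormedModule)). auto_derive. easy.
Qed.

Lemma is_derive_Rpower_exp (x t : R) : 0 < t ->
  is_derive (fun u => Rpower u x * exp (- u)) t
    (x * gamma_integrand x t - gamma_integrand (x + 1) t).
Proof.
  intros Ht. unfold gamma_integrand.
  replace (x + 1 - 1) with x by ring.
  evar_last.
  - apply (is_derive_mult (fun u => Rpower u x) (fun u => exp (- u))).
    + now apply is_derive_Rpower.
    + auto_derive; [easy|reflexivity].
    + intros; apply Rmult_comm.
  - unfold plus, mult; simpl. ring.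
Qed.

Lemma is_RInt_gen_gamma_S (x l : R) : 0 < x ->
  is_RInt_gen (gamma_integrand x) (at_right 0) (Rbar_locally p_infty) l ->
  is_RInt_gen (gamma_integrand (x + 1)) (at_right 0) (Rbar_locally p_infty) (x * l).
Proof.
  intros Hx Hl.
  assert (H : is_RInt_gen (fun t => x * gamma_integrand x t - gamma_integrand (x + 1) t)
            (at_right 0) (Rbar_locally p_infty) (0 - 0)).
  { apply is_RInt_gen_derive_half_line with (fun u => Rpower u x * exp (- u)).
    - intros t Ht. now apply is_derive_Rpower_exp.
    - intros t Ht. apply (continuous_minus (V := R_NormedModule)).
      + apply (continuous_scal_r (V := R_NormedModule)). now apply continuous_gamma_integrand.
      + now apply continuous_gamma_integrand.
    - now apply Rpower_exp_vanish_right.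
    - now apply Rpower_exp_vanish_p_infty. }
  apply (is_RInt_gen_scal _ x) in Hl.
  generalize (is_RInt_gen_minus _ _ _ _ Hl H). clear.
  replace (x * l) with (minus (scal x l) (0 - 0))
    by (unfold minus, scal, plus, opp; simpl; unfold mult; simpl; ring).
  apply is_RInt_gen_ext_half_line. intros t _.
  unfold minus, scal, plus, opp; simpl; unfold mult; simpl. ring.
Qed.

Lemma ex_RInt_gen_gamma_le_1 (x : R) : 0 < x <= 1 ->
  ex_RInt_gen (gamma_integrand x) (at_right 0) (Rbar_locally p_infty).
Proof.
  intros Hx.
  apply ex_RInt_gen_bounded with (3 / x).
  - intros t Ht. now apply continuous_gamma_integrand.
  - intros t Ht. apply Rlt_le, gamma_integrand_pos.
  - intros a b Ha Hab.
    assert (Hle : forall t, 0 < t -> Rpower t x <= 1 + t).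
    { intros t Ht. apply Rle_trans with (1 := Rpower_tangent 1 x t Rlt_0_1 Ht ltac:(lra)).
      unfold Rpower at 1; rewrite ln_1, Rmult_0_r, exp_0.
      assert (x * t <= 1 * t) by (apply Rmult_le_compat_r; lra). lra. }
    (* As [t ^ x <= 1 + t], the integrand is dominated by the derivative of [F]. *)
    set (F := fun t => / x * (Rpower t x * exp (- t) - (2 + t) * exp (- t))).
    set (f := fun t => / x * (x * gamma_integrand x t - gamma_integrand (x + 1) t
                + (1 + t) * exp (- t))).
    assert (HF : is_RInt f a b (F b - F a)).
    { apply (is_RInt_derive (V := R_CompleteNormedModule) F f).
      - intros t Ht. rewrite Rmin_left in Ht by easy. unfold F, f.
        apply is_derive_scal.
        evar_last.
        + apply (is_derive_minus (V := R_NormedModule)).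
          * apply is_derive_Rpower_exp; lra.
          * auto_derive; [easy|reflexivity].
        + unfold minus, plus, opp; simpl. ring.
      - intros t Ht. rewrite Rmin_left in Ht by easy. unfold f.
        apply (continuous_scal_r (V := R_NormedModule)).
        apply (continuous_plus (V := R_NormedModule)).
        + apply (continuous_minus (V := R_NormedModule)).
          * apply (continuous_scal_r (V := R_NormedModule)), continuous_gamma_integrand; lra.
          * apply continuous_gamma_integrand; lra.
        + apply (ex_derive_continuous (V := R_NormedModule)). auto_derive. easy. }
    apply Rle_trans with (F b - F a).
    + rewrite <- (is_RInt_unique _ _ _ _ HF). apply RInt_le; trivial.
      * apply ex_RInt_half_line; try lra. intros; now apply continuous_gamma_integrand.
      * eexists. exact HF.
      * intros t Ht. unfold f.
        apply Rmult_le_reg_l with x; [lra|].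
        rewrite <- Rmult_assoc, Rinv_r, Rmult_1_l by lra.
        unfold gamma_integrand at 3. replace (x + 1 - 1) with x by ring.
        assert (Rpower t x * exp (- t) <= (1 + t) * exp (- t)).
        { apply Rmult_le_compat_r; [apply Rlt_le, exp_pos|]. apply Hle; lra. }
        lra.
    + unfold F, Rdiv. rewrite <- Rmult_minus_distr_l, Rmult_comm.
      apply Rmult_le_compat_r; [apply Rlt_le, Rinv_0_lt_compat; lra|].
      assert (He : forall t, (1 + t) * exp (- t) <= 1).
      { intros t. apply Rle_trans with (exp t * exp (- t)).
        2: rewrite <- exp_plus, Rplus_opp_r, exp_0; apply Rle_refl.
        apply Rmult_le_compat_r; [apply Rlt_le, exp_pos|].
        apply exp_ineq1_le. }
      assert (H1 : Rpower b x * exp (- b) <= 1).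
      { apply Rle_trans with (2 := He b).
        apply Rmult_le_compat_r; [apply Rlt_le, exp_pos|]. apply Hle; lra. }
      assert (H2 := He a).
      assert (H3 : exp (- a) <= 1) by (rewrite <- exp_0; apply Rlt_le, exp_increasing; lra).
      assert (H4 : 0 < Rpower a x * exp (- a)) by (apply Rmult_lt_0_compat; apply exp_pos).
      assert (H5 : 0 < (2 + b) * exp (- b)) by (apply Rmult_lt_0_compat; [lra | apply exp_pos]).
      lra.
Qed.

Lemma is_RInt_gen_Gamma (x : R) : 0 < x ->
  is_RInt_gen (gamma_integrand x) (at_right 0) (Rbar_locally p_infty) (Gamma x).
Proof.
  intros Hx. apply (RInt_gen_correct (V := R_CompleteNormedModule)).
  assert (H : forall n y, 0 < y <= INR n + 1 ->
    ex_RInt_gen (gamma_integrand y) (at_right 0) (Rbar_locally p_infty)).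
  { induction n as [|n IH]; intros y Hy.
    - apply ex_RInt_gen_gamma_le_1. simpl in Hy. lra.
    - destruct (Rle_or_lt y 1) as [H1|H1].
      + now apply ex_RInt_gen_gamma_le_1.
      + rewrite S_INR in Hy. destruct (IH (y - 1)) as [l Hl]; [lra|].
        exists ((y - 1) * l). replace y with (y - 1 + 1) at 1 by ring.
        apply is_RInt_gen_gamma_S; trivial. lra. }
  destruct (nfloor_ex x (Rlt_le _ _ Hx)) as [n Hn].
  apply (H n). lra.
Qed.

Lemma Gamma_is_RInt_gen (x l : R) :
  is_RInt_gen (gamma_integrand x) (at_right 0) (Rbar_locally p_infty) l -> Gamma x = l.
Proof. apply (is_RInt_gen_unique (V := R_CompleteNormedModule)). Qed.

Lemma Gamma_S (x : R) : 0 < x -> Gamma (x + 1) = x * Gamma x.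
Proof.
  intros Hx. now apply Gamma_is_RInt_gen, is_RInt_gen_gamma_S, is_RInt_gen_Gamma.
Qed.

Lemma Gamma_1 : Gamma 1 = 1.
Proof.
  apply Gamma_is_RInt_gen. replace 1 with (0 - (-1)) at 2 by ring.
  apply is_RInt_gen_derive_half_line with (fun t => - exp (- t)).
  - intros t Ht. unfold gamma_integrand.
    replace (1 - 1) with 0 by ring. rewrite Rpower_O by easy.
    auto_derive; trivial. ring.
  - intros t Ht. now apply continuous_gamma_integrand.
  - apply (filterlim_filter_le_1 _ (filter_le_within (F := locally 0) (fun u => 0 < u))).
    replace (-1) with (- exp (- 0)) by (rewrite Ropp_0, exp_0; reflexivity).
    apply (ex_derive_continuous (V := R_NormedModule) (fun t => - exp (- t))).
    auto_derive. easy.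
  - apply filterlim_locally. intros eps. exists (/ eps). intros t Ht.
    assert (Heps := cond_pos eps).
    assert (0 < / eps) by now apply Rinv_0_lt_compat.
    change (Rabs (- exp (- t) - 0) < eps).
    rewrite Rminus_0_r, Rabs_Ropp, Rabs_pos_eq by apply Rlt_le, exp_pos.
    rewrite exp_Ropp. rewrite <- (Rinv_inv eps). apply Rinv_lt_contravar.
    + apply Rmult_lt_0_compat; trivial. apply exp_pos.
    + generalize (exp_ineq1_le t). lra.
Qed.

(* Wendel's inequality, by integrating [Rpower_tangent] at [c = p]. *)
Lemma Gamma_plus_le (p s : R) : 0 < p -> 0 <= s <= 1 ->
  Gamma (p + s) <= Rpower p s * Gamma p.
Proof.
  intros Hp Hs.
  replace (Rpower p s * Gamma p) with
    (Rpower p s * ((1 - s) * Gamma p + s / p * Gamma (p + 1)))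
    by (rewrite Gamma_S by easy; field; lra).
  apply is_RInt_gen_le with (gamma_integrand (p + s))
    (fun t => scal (Rpower p s) (plus (scal (1 - s) (gamma_integrand p t))
                 (scal (s / p) (gamma_integrand (p + 1) t)))).
  - intros t Ht. rewrite gamma_integrand_plus, gamma_integrand_S by easy.
    unfold scal, plus; simpl; unfold mult; simpl.
    apply Rle_trans with (Rpower p s * (1 - s + s / p * t) * gamma_integrand p t).
    + apply Rmult_le_compat_r; [apply Rlt_le, gamma_integrand_pos|].
      now apply Rpower_tangent.
    + apply Req_le. ring.
  - apply is_RInt_gen_Gamma. lra.
  - apply (is_RInt_gen_scal (V := R_NormedModule)).
    apply (is_RInt_gen_plus (V := R_NormedModule));
      apply (is_RInt_gen_scal (V := R_NormedModule)); apply is_RInt_gen_Gamma; lra.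
Qed.

Lemma Gamma_pos (x : R) : 0 < x -> 0 < Gamma x.
Proof.
  intros Hx.
  assert (H2 : 0 < Gamma (1 + 1)) by (rewrite Gamma_S, Gamma_1; lra).
  assert (Hb : forall y, 0 < y <= 1 -> 0 < Gamma y).
  { intros y Hy.
    assert (H := Gamma_plus_le (y + 1) (1 - y) ltac:(lra) ltac:(lra)).
    replace (y + 1 + (1 - y)) with (1 + 1) in H by ring.
    rewrite (Gamma_S y) in H by lra.
    apply Rnot_le_lt. intros Hn.
    assert (0 < Rpower (y + 1) (1 - y) * y) by (apply Rmult_lt_0_compat; [apply Rpower_pos|lra]).
    assert (Rpower (y + 1) (1 - y) * y * Gamma y <= Rpower (y + 1) (1 - y) * y * 0)
      by (apply Rmult_le_compat_l; lra).
    lra. }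
  destruct (nfloor_ex x (Rlt_le _ _ Hx)) as [n Hn].
  assert (Hx' : 0 < x <= INR n + 1) by lra. clear Hn Hx. revert x Hx'.
  induction n as [|n IH]; intros y Hy.
  - apply Hb. simpl in Hy. lra.
  - destruct (Rle_or_lt y 1) as [H1|H1]; [now apply Hb|].
    rewrite S_INR in Hy. replace y with (y - 1 + 1) by ring.
    rewrite Gamma_S by lra. apply Rmult_lt_0_compat; [lra|]. apply IH. lra.
Qed.

(** * Growth of log Gamma *)

Lemma is_lim_seq_inv_INR_plus (c : R) : is_lim_seq (fun N => / (INR N + c)) 0.
Proof.
  replace (Finite 0) with (Rbar_inv p_infty) by easy.
  apply is_lim_seq_inv; [|easy].
  eapply is_lim_seq_plus; [apply is_lim_seq_INR | apply is_lim_seq_const | easy].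
Qed.

Lemma Gamma_asymptotic_base (x : R) : 0 <= x <= 1 ->
  is_lim_seq (fun N => ln (Gamma (INR N + 1 + x)) - ln (Gamma (INR N + 1)) - x * ln (INR N + 1)) 0.
Proof.
  intros Hx.
  apply is_lim_seq_le_le with (fun N => - / (INR N + 1)) (fun _ => 0).
  - intros N. assert (HN := pos_INR N). set (p := INR N + 1).
    assert (Hp : 0 < p) by (unfold p; lra).
    assert (H1 := Gamma_plus_le p x Hp Hx).
    assert (H2 := Gamma_plus_le (p + x) (1 - x) ltac:(lra) ltac:(lra)).
    replace (p + x + (1 - x)) with (p + 1) in H2 by ring.
    rewrite Gamma_S in H2 by easy.
    assert (Hg := Gamma_pos p Hp). assert (Hgx := Gamma_pos (p + x) ltac:(lra)).
    apply ln_le in H1; [|easy].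
    apply ln_le in H2; [|now apply Rmult_lt_0_compat].
    rewrite !ln_mult in * by (trivial; apply Rpower_pos).
    unfold Rpower in H1, H2. rewrite ln_exp in H1, H2.
    split; [|lra].
    assert (H3 : ln (p + x) - ln p <= / p).
    { assert (H := ln_le_sub ((p + x) / p) ltac:(apply Rdiv_lt_0_compat; lra)).
      unfold Rdiv in H. rewrite ln_mult, ln_Rinv in H by (try apply Rinv_0_lt_compat; lra).
      replace ((p + x) * / p - 1) with (x * / p) in H by (field; lra).
      assert (x * / p <= 1 * / p)
        by (apply Rmult_le_compat_r; [apply Rlt_le, Rinv_0_lt_compat|]; lra). lra. }
    assert (Hip := Rinv_0_lt_compat _ Hp).
    assert (H4 : (1 - x) * (ln (p + x) - ln p) <= (1 - x) * / p)
      by (apply Rmult_le_compat_l; lra).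
    assert (H5 : (1 - x) * / p <= 1 * / p) by (apply Rmult_le_compat_r; lra).
    lra.
  - replace (Finite 0) with (Rbar_opp 0) by (simpl; f_equal; ring).
    apply -> is_lim_seq_opp. apply is_lim_seq_inv_INR_plus.
  - apply is_lim_seq_const.
Qed.

Lemma is_lim_seq_mul_ln_ratio (x : R) : -1 < x ->
  is_lim_seq (fun N => (INR N + 1 + x) * (ln (INR N + 1 + x) - ln (INR N + 1))) x.
Proof.
  intros Hx.
  apply is_lim_seq_le_le with (fun _ => x) (fun N => x + x * x * / (INR N + 1)).
  - intros N. assert (HN := pos_INR N). set (p := INR N + 1).
    assert (Hp : 0 < p) by (unfold p; lra).
    assert (Hpx : 0 < p + x) by (unfold p; lra).
    replace (ln (p + x) - ln p) with (ln ((p + x) / p)).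
    2:{ unfold Rdiv. rewrite ln_mult, ln_Rinv by (try apply Rinv_0_lt_compat; lra). ring. }
    assert (Hq : 0 < (p + x) / p) by (now apply Rdiv_lt_0_compat).
    split.
    + replace x with ((p + x) * (1 - / ((p + x) / p))) at 1 by (field; lra).
      apply Rmult_le_compat_l; [lra|]. now apply ln_ge_sub.
    + replace (x + x * x * / p) with ((p + x) * ((p + x) / p - 1)) by (field; lra).
      apply Rmult_le_compat_l; [lra|]. now apply ln_le_sub.
  - apply is_lim_seq_const.
  - evar_last.
    + eapply is_lim_seq_plus.
      * apply is_lim_seq_const.
      * apply (is_lim_seq_scal_l _ (x * x) 0).
        apply is_lim_seq_inv_INR_plus.
      * easy.
    + simpl. f_equal. ring.
Qed.

Lemma is_lim_seq_ln_ratio (x : R) : -1 < x ->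
  is_lim_seq (fun N => ln (INR N + 1 + x) - ln (INR N + 1)) 0.
Proof.
  intros Hx.
  apply is_lim_seq_ext with (fun N =>
    (INR N + 1 + x) * (ln (INR N + 1 + x) - ln (INR N + 1)) * / (INR N + 1 + x)).
  { intros N. assert (HN := pos_INR N). field. lra. }
  evar_last.
  - apply is_lim_seq_mult' with (l2 := 0).
    + now apply is_lim_seq_mul_ln_ratio.
    + apply is_lim_seq_ext with (2 := is_lim_seq_inv_INR_plus (1 + x)).
      intros N. now rewrite Rplus_assoc.
  - f_equal. ring.
Qed.

Lemma Gamma_asymptotic_shift (x : R) : -1 < x ->
  is_lim_seq (fun N => ln (Gamma (INR N + 1 + x)) - ln (Gamma (INR N + 1)) - x * ln (INR N + 1)) 0 <->
  is_lim_seq (fun N => ln (Gamma (INR N + 1 + (x + 1))) - ln (Gamma (INR N + 1)) - (x + 1) * ln (INR N + 1)) 0.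
Proof.
  intros Hx. assert (Hr := is_lim_seq_ln_ratio x Hx).
  assert (E : forall N, ln (Gamma (INR N + 1 + (x + 1))) =
              ln (INR N + 1 + x) + ln (Gamma (INR N + 1 + x))).
  { intros N. assert (HN := pos_INR N).
    replace (INR N + 1 + (x + 1)) with (INR N + 1 + x + 1) by ring.
    assert (HG := Gamma_pos (INR N + 1 + x) ltac:(lra)).
    rewrite Gamma_S, ln_mult; trivial; lra. }
  split; intros H.
  - generalize (is_lim_seq_plus' _ _ _ _ H Hr). rewrite Rplus_0_r.
    apply is_lim_seq_ext. intros N. rewrite E. ring.
  - generalize (is_lim_seq_minus' _ _ _ _ H Hr). rewrite Rminus_0_r.
    apply is_lim_seq_ext. intros N. rewrite E. ring.
Qed.

Lemma Gamma_asymptotic (x : R) : -1 < x ->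
  is_lim_seq (fun N => ln (Gamma (INR N + 1 + x)) - ln (Gamma (INR N + 1)) - x * ln (INR N + 1)) 0.
Proof.
  intros Hx.
  assert (H : forall n y, 0 <= y <= INR n + 1 ->
    is_lim_seq (fun N => ln (Gamma (INR N + 1 + y)) - ln (Gamma (INR N + 1)) - y * ln (INR N + 1)) 0).
  { induction n as [|n IH]; intros y Hy.
    - apply Gamma_asymptotic_base. simpl in Hy. lra.
    - destruct (Rle_or_lt y 1) as [H1|H1]; [now apply Gamma_asymptotic_base|].
      rewrite S_INR in Hy. replace y with (y - 1 + 1) by ring.
      apply -> Gamma_asymptotic_shift; [|lra]. apply IH. lra. }
  apply <- Gamma_asymptotic_shift; trivial.
  destruct (nfloor_ex (x + 1)) as [n Hn]; [lra|]. apply (H n). lra.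
Qed.

(** * The Binet integral *)

Definition binet_kernel (n k : nat) (x s : R) : R :=
  s / ((INR (S k) + s) * (INR (S k) + s + x) ^ S n).

Definition binet_term (n k : nat) (x : R) : R := RInt (binet_kernel n k x) 0 1.

(* With [y = k + 1 + s] this is the integral over [y > 1] of [frac(y) / (y * (y + x) ^ (n + 1))]. *)
Definition binet (n : nat) (x : R) : R := Series (fun k => binet_term n k x).

Lemma INR_S_ge_1 (k : nat) : 1 <= INR (S k).
Proof. rewrite S_INR. generalize (pos_INR k). lra. Qed.

Lemma ex_RInt_binet_kernel (n k : nat) (x : R) : -1 < x ->
  ex_RInt (binet_kernel n k x) 0 1.
Proof.
  intros Hx. apply (ex_RInt_continuous (V := R_CompleteNormedModule)).
  intros s Hs. rewrite Rmin_left, Rmax_right in Hs by lra.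
  assert (Hk := INR_S_ge_1 k).
  apply (ex_derive_continuous (V := R_NormedModule)).
  unfold binet_kernel. generalize dependent (INR (S k)). intros K Hk.
  generalize (S n). intros m. auto_derive.
  apply Rmult_integral_contrapositive_currified; [lra|]. apply pow_nonzero. lra.
Qed.

(* With [K = INR (S k)], the constant comes from [K + s + x >= (K - 1) + (1 + x)]. *)
Lemma inv_shift_le (k : nat) (x s : R) : -1 < x -> 0 <= s ->
  / (INR (S k) + s + x) <= (1 + / (1 + x)) * / INR (S k).
Proof.
  intros Hx Hs. assert (Hk := INR_S_ge_1 k). set (K := INR (S k)) in *.
  assert (0 < K + s + x) by lra.
  apply Rmult_le_reg_l with (K + s + x); trivial. rewrite Rinv_r by lra.
  apply Rmult_le_reg_r with K; [lra|].
  replace ((K + s + x) * ((1 + / (1 + x)) * / K) * K)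
    with (1 + K + s + x + (K - 1) / (1 + x) + s / (1 + x)) by (field; lra).
  assert (0 <= (K - 1) / (1 + x)) by (apply Rdiv_le_0_compat; lra).
  assert (0 <= s / (1 + x)) by (apply Rdiv_le_0_compat; lra).
  lra.
Qed.

Lemma weight_le (k : nat) (s : R) : 0 <= s <= 1 ->
  0 <= s / (INR (S k) + s) <= / INR (S k).
Proof.
  intros Hs. assert (Hk := INR_S_ge_1 k). set (K := INR (S k)) in *. split.
  - apply Rdiv_le_0_compat; lra.
  - apply Rmult_le_reg_r with (K + s); [lra|].
    replace (s / (K + s) * (K + s)) with s by (field; lra).
    replace (/ K * (K + s)) with (1 + s / K) by (field; lra).
    assert (0 <= s / K) by (apply Rdiv_le_0_compat; lra). lra.
Qed.

Lemma ex_series_Rmult (c : R) (a : nat -> R) :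
  ex_series a -> ex_series (fun k => c * a k).
Proof. apply (ex_series_scal_l (V := R_NormedModule) c a). Qed.

Lemma ex_series_inv_square : ex_series (fun k => / INR (S k) * / INR (S k)).
Proof.
  assert (H : ex_series (fun k => 2 * (/ INR (S k) - / INR (S (S k))))).
  { apply ex_series_Rmult.
    exists 1. change (is_lim_seq (sum_n (fun k => / INR (S k) - / INR (S (S k)))) 1).
    apply (is_lim_seq_ext (fun N => 1 - / INR (S (S N)))).
    - induction n as [|n IH].
      + rewrite sum_O. simpl. field.
      + rewrite sum_Sn, <- IH. unfold plus; simpl. ring.
    - replace (Finite 1) with (Finite (1 - 0)) by (f_equal; ring).
      apply is_lim_seq_minus'; [apply is_lim_seq_const|].
      apply is_lim_seq_ext with (2 := is_lim_seq_inv_INR_plus 2).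
      intros N. rewrite !S_INR. f_equal. ring. }
  apply (ex_series_le (K := R_AbsRing) (V := R_CompleteNormedModule)) with (2 := H).
  intros k. change (norm (/ INR (S k) * / INR (S k))) with (Rabs (/ INR (S k) * / INR (S k))).
  assert (Hk := INR_S_ge_1 k). rewrite (S_INR (S k)). set (K := INR (S k)) in *.
  assert (0 < / K) by (apply Rinv_0_lt_compat; lra).
  rewrite Rabs_pos_eq by (apply Rmult_le_pos; lra).
  replace (2 * (/ K - / (K + 1))) with (/ K * (2 * / (K + 1))) by (field; lra).
  apply Rmult_le_compat_l; [lra|].
  apply Rmult_le_reg_r with (K * (K + 1)); [apply Rmult_lt_0_compat; lra|].
  replace (/ K * (K * (K + 1))) with (K + 1) by (field; lra).
  replace (2 * / (K + 1) * (K * (K + 1))) with (2 * K) by (field; lra). lra.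
Qed.

Lemma binet_term_bounds (n k : nat) (x : R) : -1 < x ->
  0 <= binet_term n k x <=
  (/ (1 + x)) ^ n * (1 + / (1 + x)) * (/ INR (S k) * / INR (S k)).
Proof.
  intros Hx. unfold binet_term. assert (Hk := INR_S_ge_1 k).
  assert (HC : 0 < / (1 + x)) by (apply Rinv_0_lt_compat; lra).
  assert (Hb : forall s, 0 <= s <= 1 -> 0 <= binet_kernel n k x s <=
    (/ (1 + x)) ^ n * (1 + / (1 + x)) * (/ INR (S k) * / INR (S k))).
  { intros s Hs. unfold binet_kernel.
    assert (Hw := weight_le k s Hs).
    assert (Hi := inv_shift_le k x s Hx (proj1 Hs)).
    set (K := INR (S k)) in *.
    assert (Hq : 0 < / (K + s + x)) by (apply Rinv_0_lt_compat; lra).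
    assert (Hq1 : / (K + s + x) <= / (1 + x)) by (apply Rinv_le_contravar; lra).
    assert (Hp : 0 < (K + s + x) ^ n) by (apply pow_lt; lra).
    replace (s / ((K + s) * (K + s + x) ^ S n)) with
      ((/ (K + s + x)) ^ n * / (K + s + x) * (s / (K + s))).
    2:{ rewrite pow_inv. simpl. field. lra. }
    assert (Hn : 0 <= (/ (K + s + x)) ^ n <= (/ (1 + x)) ^ n).
    { split; [apply pow_le; lra|]. apply pow_incr; lra. }
    split.
    - apply Rmult_le_pos; [apply Rmult_le_pos|]; lra.
    - replace ((/ (1 + x)) ^ n * (1 + / (1 + x)) * (/ K * / K)) with
        ((/ (1 + x)) ^ n * ((1 + / (1 + x)) * / K) * / K) by ring.
      apply Rmult_le_compat; try lra. apply Rmult_le_pos; lra.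
      apply Rmult_le_compat; lra. }
  split.
  - apply RInt_ge_0; [lra | now apply ex_RInt_binet_kernel |].
    intros s Hs. apply Hb; lra.
  - apply Rle_trans with (1 := Rle_abs _).
    rewrite <- (Rmult_1_l (_ ^ n * _ * _)). replace 1 with (1 - 0) at 2 by ring.
    apply abs_RInt_le_const; [lra | now apply ex_RInt_binet_kernel |].
    intros s Hs. rewrite Rabs_pos_eq; now apply Hb.
Qed.

Lemma ex_series_binet (n : nat) (x : R) : -1 < x -> ex_series (fun k => binet_term n k x).
Proof.
  intros Hx.
  apply (ex_series_le (K := R_AbsRing) (V := R_CompleteNormedModule)) with
    (fun k => (/ (1 + x)) ^ n * (1 + / (1 + x)) * (/ INR (S k) * / INR (S k))).
  - intros k. change (norm (binet_term n k x)) with (Rabs (binet_term n k x)).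
    rewrite Rabs_pos_eq; now apply binet_term_bounds.
  - apply ex_series_Rmult, ex_series_inv_square.
Qed.

Lemma binet_nonneg (n : nat) (x : R) : -1 < x -> 0 <= binet n x.
Proof.
  intros Hx. unfold binet.
  apply Rle_trans with (Series (fun _ => 0 * 0)).
  - rewrite Series_scal_l. lra.
  - apply Series_le; [|now apply ex_series_binet].
    intros k. rewrite Rmult_0_l. split; [lra|]. now apply binet_term_bounds.
Qed.

(* First-order Taylor remainder of [1 / a ^ m], with [q = 1 / a] and [p = 1 / (a + h)]:
   the remainders satisfy [R (m + 1) = p R m + (m + 1) h ^ 2 p q ^ (m + 2)]. *)
Lemma pow_inv_remainder (p q h B : R) (m : nat) :
  0 <= p <= B -> 0 <= q <= B -> p - q = - (h * p * q) ->
  0 <= p ^ m - q ^ m + INR m * h * q ^ S m <= INR m ^ 2 * h ^ 2 * B ^ S m * q.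
Proof.
  intros Hp Hq E. induction m as [|m IH].
  - simpl. lra.
  - set (r := p ^ m - q ^ m + INR m * h * q ^ S m) in *.
    assert (Hh : 0 <= h ^ 2) by apply pow2_ge_0.
    assert (Hm := pos_INR m).
    assert (Hqm : 0 <= q ^ m <= B ^ m) by (split; [apply pow_le; lra | apply pow_incr; lra]).
    assert (HBm : 0 <= B ^ S m) by (apply pow_le; lra).
    replace (p ^ S m - q ^ S m + INR (S m) * h * q ^ S (S m))
      with (p * r + INR (S m) * h ^ 2 * (p * q ^ S m * q)).
    2:{ unfold r. rewrite S_INR. simpl.
        assert (E2 : h * p * q = q - p) by lra.
        replace ((INR m + 1) * (h * (h * 1)) * (p * (q * q ^ m) * q)) with
          ((INR m + 1) * h * (h * p * q) * (q * q ^ m)) by ring.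
        rewrite E2.
        replace (p * (p ^ m - q ^ m + INR m * h * (q * q ^ m)) +
          (INR m + 1) * h * (q - p) * (q * q ^ m)) with
          (p * p ^ m - p * q ^ m - (h * p * q) * q ^ m + (INR m + 1) * h * (q * (q * q ^ m)))
          by ring.
        rewrite E2. ring. }
    assert (Hpq : 0 <= p * q ^ S m <= B ^ S (S m)).
    { assert (0 <= q ^ S m <= B ^ S m) by (split; [apply pow_le; lra | apply pow_incr; lra]).
      change (B ^ S (S m)) with (B * B ^ S m). split.
      - apply Rmult_le_pos; lra.
      - apply Rmult_le_compat; lra. }
    assert (H1 : 0 <= INR (S m) * h ^ 2) by (apply Rmult_le_pos; [apply pos_INR | easy]).
    split.
    + apply Rplus_le_le_0_compat; repeat (apply Rmult_le_pos; try lra).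
    + assert (H2 : p * r <= B * (INR m ^ 2 * h ^ 2 * B ^ S m * q))
        by (apply Rmult_le_compat; lra).
      assert (H3 : INR (S m) * h ^ 2 * (p * q ^ S m * q) <=
                   INR (S m) * h ^ 2 * (B ^ S (S m) * q)).
      { apply Rmult_le_compat_l; trivial. apply Rmult_le_compat_r; lra. }
      assert (H4 : 0 <= INR m * (h ^ 2 * B ^ S (S m) * q)).
      { assert (0 <= B ^ S (S m)) by (apply pow_le; lra).
        apply Rmult_le_pos; trivial. apply Rmult_le_pos; [|lra]. now apply Rmult_le_pos. }
      rewrite S_INR in *. change (B ^ S (S m)) with (B * B ^ S m) in *. lra.
Qed.

Lemma is_derive_quadratic_remainder (f : R -> R) (x l M d : R) : 0 < d ->
  (forall h, Rabs h < d -> Rabs (f (x + h) - f x - l * h) <= M * h ^ 2) ->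
  is_derive f x l.
Proof.
  intros Hd H. apply is_derive_Reals. intros eps Heps.
  assert (HM := Rabs_pos M).
  assert (Hq : 0 < eps / (Rabs M + 1)) by (apply Rdiv_lt_0_compat; lra).
  exists (mkposreal _ (Rmin_glb_lt _ _ _ Hd Hq)). intros h Hh0 Hh. simpl in Hh.
  assert (Hh1 := Rlt_le_trans _ _ _ Hh (Rmin_l _ _)).
  assert (Hh2 := Rlt_le_trans _ _ _ Hh (Rmin_r _ _)).
  assert (Hp : 0 < Rabs h) by now apply Rabs_pos_lt.
  replace ((f (x + h) - f x) / h - l) with ((f (x + h) - f x - l * h) / h)
    by (field; trivial).
  unfold Rdiv. rewrite Rabs_mult, Rabs_inv.
  apply Rmult_lt_reg_r with (Rabs h); trivial.
  rewrite Rmult_assoc, Rinv_l, Rmult_1_r by lra.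
  apply Rle_lt_trans with (1 := H h Hh1).
  apply Rle_lt_trans with ((Rabs M + 1) * Rabs h * Rabs h).
  - replace ((Rabs M + 1) * Rabs h * Rabs h) with ((Rabs M + 1) * h ^ 2).
    + apply Rmult_le_compat_r; [apply pow2_ge_0|]. generalize (Rle_abs M). lra.
    + rewrite <- (pow2_abs h). ring.
  - apply Rmult_lt_compat_r; trivial.
    apply Rlt_le_trans with ((Rabs M + 1) * (eps / (Rabs M + 1))).
    + apply Rmult_lt_compat_l; lra.
    + apply Req_le. field. lra.
Qed.

Lemma binet_kernel_remainder (n k : nat) (x h s : R) :
  -1 < x -> Rabs h < (1 + x) / 2 -> 0 <= s <= 1 ->
  Rabs (binet_kernel n k (x + h) s - binet_kernel n k x s
        + INR (S n) * h * binet_kernel (S n) k x s) <=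
  INR (S n) ^ 2 * h ^ 2 * (2 / (1 + x)) ^ S (S n) * (1 + / (1 + x))
    * (/ INR (S k) * / INR (S k)).
Proof.
  intros Hx Hh Hs. apply Rabs_def2 in Hh.
  assert (Hk := INR_S_ge_1 k). assert (Hw := weight_le k s Hs).
  assert (Hi := inv_shift_le k x s Hx (proj1 Hs)).
  unfold binet_kernel. set (K := INR (S k)) in *. set (a := K + s + x).
  replace (K + s + (x + h)) with (a + h) by (unfold a; ring).
  assert (Ha : 0 < a) by (unfold a; lra).
  assert (Hah : 0 < a + h) by (unfold a; lra).
  set (p := / (a + h)). set (q := / a). fold a in Hi; fold q in Hi.
  assert (Hp0 : 0 < p) by now apply Rinv_0_lt_compat.
  assert (Hq0 : 0 < q) by now apply Rinv_0_lt_compat.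
  assert (HB : forall b, (1 + x) / 2 <= b -> / b <= 2 / (1 + x)).
  { intros b Hb. replace (2 / (1 + x)) with (/ ((1 + x) / 2)) by (field; lra).
    apply Rinv_le_contravar; lra. }
  assert (Hp : p <= 2 / (1 + x)) by (apply HB; unfold a; lra).
  assert (Hq : q <= 2 / (1 + x)) by (apply HB; unfold a; lra).
  assert (E : p - q = - (h * p * q)) by (unfold p, q; field; lra).
  destruct (pow_inv_remainder p q h (2 / (1 + x)) (S n)) as [R0 R1]; try lra.
  replace (s / ((K + s) * (a + h) ^ S n) - s / ((K + s) * a ^ S n)
    + INR (S n) * h * (s / ((K + s) * a ^ S (S n)))) with
    ((p ^ S n - q ^ S n + INR (S n) * h * q ^ S (S n)) * (s / (K + s))).
  2:{ unfold p, q. rewrite !pow_inv.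
      assert (a ^ S n <> 0) by (apply pow_nonzero; lra).
      assert ((a + h) ^ S n <> 0) by (apply pow_nonzero; lra).
      assert (a ^ S (S n) <> 0) by (apply pow_nonzero; lra).
      field. repeat split; trivial; lra. }
  rewrite Rabs_pos_eq by (apply Rmult_le_pos; lra).
  rewrite <- Rmult_assoc.
  apply Rmult_le_compat; try lra.
  apply Rle_trans with (1 := R1). rewrite (Rmult_assoc _ (1 + _)).
  apply Rmult_le_compat_l; trivial.
  apply Rmult_le_pos; [apply Rmult_le_pos; apply pow2_ge_0|].
  apply pow_le. apply Rle_trans with (2 := Hp). lra.
Qed.

Lemma is_derive_binet (n : nat) (x : R) : -1 < x ->
  is_derive (binet n) x (- INR (S n) * binet (S n) x).
Proof.
  intros Hx.
  set (M := INR (S n) ^ 2 * (2 / (1 + x)) ^ S (S n) * (1 + / (1 + x))).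
  apply is_derive_quadratic_remainder with
    (M * Series (fun k => / INR (S k) * / INR (S k))) ((1 + x) / 2); [lra|].
  intros h Hh.
  assert (Hxh : -1 < x + h) by (apply Rabs_def2 in Hh; lra).
  assert (E : binet n (x + h) - binet n x - - INR (S n) * binet (S n) x * h =
    Series (fun k => binet_term n k (x + h) - binet_term n k x
                     + INR (S n) * h * binet_term (S n) k x)).
  { unfold binet.
    rewrite Series_plus, Series_minus, Series_scal_l; try now apply ex_series_binet.
    - ring.
    - apply (ex_series_minus (V := R_NormedModule)); now apply ex_series_binet.
    - apply ex_series_Rmult. now apply ex_series_binet. }
  rewrite E. clear E.
  assert (Hb : forall k, Rabs (binet_term n k (x + h) - binet_term n k x
       + INR (S n) * h * binet_term (S n) k x) <= M * h ^ 2 * (/ INR (S k) * / INR (S k))).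
  { intros k. unfold binet_term.
    assert (HI : is_RInt (fun s => binet_kernel n k (x + h) s - binet_kernel n k x s
        + INR (S n) * h * binet_kernel (S n) k x s) 0 1
      (RInt (binet_kernel n k (x + h)) 0 1 - RInt (binet_kernel n k x) 0 1
        + INR (S n) * h * RInt (binet_kernel (S n) k x) 0 1)).
    { apply (is_RInt_plus (V := R_NormedModule)).
      - apply (is_RInt_minus (V := R_NormedModule));
          now apply (RInt_correct (V := R_CompleteNormedModule)), ex_RInt_binet_kernel.
      - apply (is_RInt_scal (V := R_NormedModule)).
        now apply (RInt_correct (V := R_CompleteNormedModule)), ex_RInt_binet_kernel. }
    rewrite <- (is_RInt_unique _ _ _ _ HI).
    rewrite <- (Rmult_1_l (M * _ * _)). replace 1 with (1 - 0) at 2 by ring.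
    apply abs_RInt_le_const; [lra | now eexists; apply HI |].
    intros s Hs. eapply Rle_trans; [now apply binet_kernel_remainder|].
    apply Req_le. unfold M. ring. }
  assert (Hs : ex_series (fun k => M * h ^ 2 * (/ INR (S k) * / INR (S k))))
    by (apply ex_series_Rmult, ex_series_inv_square).
  apply Rle_trans with (Series (fun k => M * h ^ 2 * (/ INR (S k) * / INR (S k)))).
  - eapply Rle_trans; [apply Series_Rabs|].
    + apply (ex_series_le (K := R_AbsRing) (V := R_CompleteNormedModule)) with (2 := Hs).
      intros k.
      match goal with |- norm ?u <= _ => change (norm u) with (Rabs u) end.
      rewrite Rabs_Rabsolu. apply Hb.
    + apply Series_le; trivial. intros k. split; [apply Rabs_pos | apply Hb].
  - rewrite Series_scal_l. apply Req_le. ring.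
Qed.

Lemma is_derive_shift_ln (c s : R) : 0 < c + s ->
  is_derive (fun u => ln (c + u)) s (/ (c + s)).
Proof. intros H. auto_derive; trivial. field. lra. Qed.

Lemma binet_term_closed (k : nat) (x : R) : -1 < x ->
  x * binet_term 0 k x =
  (INR (S k) + x) * (ln (INR (S k) + 1 + x) - ln (INR (S k) + x))
  - INR (S k) * (ln (INR (S k) + 1) - ln (INR (S k))).
Proof.
  intros Hx. assert (HI := ex_RInt_binet_kernel 0 k x Hx). unfold binet_term, binet_kernel in *.
  assert (Hk := INR_S_ge_1 k). set (K := INR (S k)) in *.
  rewrite <- (RInt_scal (V := R_CompleteNormedModule)) by apply HI.
  set (F := fun s => (K + x) * ln (K + x + s) - K * ln (K + s)).
  replace (K + 1 + x) with (K + x + 1) by ring.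
  replace (_ - _) with (F 1 - F 0) by (unfold F; rewrite !Rplus_0_r; ring).
  apply is_RInt_unique. apply (is_RInt_derive (V := R_CompleteNormedModule) F).
  - intros s Hs. rewrite Rmin_left, Rmax_right in Hs by lra. unfold F.
    evar_last.
    + apply (is_derive_minus (V := R_NormedModule));
        apply is_derive_scal, is_derive_shift_ln; lra.
    + unfold minus, plus, opp, scal; simpl; unfold mult; simpl. field. lra.
  - intros s Hs. rewrite Rmin_left, Rmax_right in Hs by lra.
    apply (continuous_scal_r (V := R_NormedModule)).
    apply (ex_derive_continuous (V := R_NormedModule)). clearbody K. auto_derive.
    rewrite Rmult_1_r. apply Rmult_integral_contrapositive_currified; lra.
Qed.

Lemma binet_term_0_closed (k : nat) :
  binet_term 0 k 0 = ln (INR (S k) + 1) - ln (INR (S k)) - / (INR (S k) + 1).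
Proof.
  unfold binet_term, binet_kernel.
  assert (Hk := INR_S_ge_1 k). set (K := INR (S k)) in *.
  set (F := fun s => ln (K + s) + K / (K + s)).
  replace (_ - _) with (F 1 - F 0) by (unfold F; rewrite !Rplus_0_r; field; split; lra).
  apply is_RInt_unique. apply (is_RInt_derive (V := R_CompleteNormedModule) F).
  - intros s Hs. rewrite Rmin_left, Rmax_right in Hs by lra. unfold F.
    clearbody K. auto_derive; [lra|]. field. lra.
  - intros s Hs. rewrite Rmin_left, Rmax_right in Hs by lra.
    apply (ex_derive_continuous (V := R_NormedModule)). clearbody K. auto_derive.
    rewrite Rmult_1_r. apply Rmult_integral_contrapositive_currified; lra.
Qed.

Lemma is_lim_seq_binet (n : nat) (x : R) : -1 < x ->
  is_lim_seq (sum_n (fun k => binet_term n k x)) (binet n x).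
Proof. intros Hx. now apply Series_correct, ex_series_binet. Qed.

Lemma sum_n_succ (a : nat -> R) (N : nat) : sum_n a (S N) = sum_n a N + a (S N) :> R.
Proof. apply (sum_Sn a). Qed.

Lemma sum_n_m_succ (a : nat -> R) (n m : nat) : (n <= S m)%nat ->
  sum_n_m a n (S m) = sum_n_m a n m + a (S m) :> R.
Proof. apply (sum_n_Sm a). Qed.

Lemma sum_binet_term (x : R) (N : nat) : -1 < x ->
  x * sum_n (fun k => binet_term 0 k x) N =
  ln (Gamma (x + 1)) - x * ln (x + 1)
  + ((INR (S N) + 1 + x) * (ln (INR (S N) + 1 + x) - ln (INR (S N) + 1))
     - (ln (INR (S N) + 1 + x) - ln (INR (S N) + 1)))
  - (ln (Gamma (INR (S N) + 1 + x)) - ln (Gamma (INR (S N) + 1)) - x * ln (INR (S N) + 1)).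
Proof.
  intros Hx.
  assert (HG : forall y, 0 < y -> ln (Gamma (y + 1)) = ln y + ln (Gamma y)).
  { intros y Hy. rewrite Gamma_S, ln_mult; trivial. now apply Gamma_pos. }
  induction N as [|N IH].
  - rewrite sum_O, binet_term_closed by easy. simpl (INR 1).
    replace (1 + 1 + x) with (x + 1 + 1) by ring. replace (1 + x) with (x + 1) by ring.
    rewrite (HG (x + 1)), (HG 1), Gamma_1, ln_1 by lra. ring.
  - rewrite sum_n_succ, Rmult_plus_distr_l, IH, binet_term_closed by easy.
    rewrite (S_INR (S N)). assert (HN := INR_S_ge_1 N). set (K := INR (S N)) in *.
    replace (K + 1 + 1 + x) with (K + 1 + x + 1) by ring.
    rewrite (HG (K + 1 + x)), (HG (K + 1)) by lra. ring.
Qed.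

Lemma binet_Gamma (x : R) : -1 < x ->
  x * binet 0 x = ln (Gamma (x + 1)) - x * ln (x + 1) + x.
Proof.
  intros Hx.
  assert (H1 : is_lim_seq (fun N => x * sum_n (fun k => binet_term 0 k x) N) (x * binet 0 x)).
  { apply (is_lim_seq_scal_l _ x (binet 0 x)). now apply is_lim_seq_binet. }
  assert (H2 : is_lim_seq (fun N => x * sum_n (fun k => binet_term 0 k x) N)
     (ln (Gamma (x + 1)) - x * ln (x + 1) + (x - 0) - 0)).
  { eapply is_lim_seq_ext; [intros N; symmetry; now apply sum_binet_term|].
    apply is_lim_seq_minus'; [|now apply (is_lim_seq_incr_1 (fun N => ln (Gamma (INR N + 1 + x))
       - ln (Gamma (INR N + 1)) - x * ln (INR N + 1))), Gamma_asymptotic].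
    apply is_lim_seq_plus'; [apply is_lim_seq_const|].
    apply is_lim_seq_minus'.
    - now apply (is_lim_seq_incr_1 (fun N => (INR N + 1 + x)
        * (ln (INR N + 1 + x) - ln (INR N + 1)))), is_lim_seq_mul_ln_ratio.
    - now apply (is_lim_seq_incr_1 (fun N => ln (INR N + 1 + x) - ln (INR N + 1))),
        is_lim_seq_ln_ratio. }
  apply is_lim_seq_unique in H1. apply is_lim_seq_unique in H2.
  rewrite H1 in H2. injection H2. intros ->. ring.
Qed.

Lemma sum_binet_term_0 (N : nat) :
  sum_n (fun k => binet_term 0 k 0) N =
  1 - (sum_n_m (fun k => / INR k) 1 (S (S N)) - ln (INR (S (S N)))) :> R.
Proof.
  induction N as [|N IH].
  - rewrite sum_O, binet_term_0_closed, sum_n_m_succ, sum_n_n by lia.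
    rewrite (S_INR 1). simpl. rewrite ln_1. field.
  - rewrite sum_n_succ, IH, (sum_n_m_succ _ 1 (S (S N))), binet_term_0_closed by lia.
    rewrite (S_INR (S (S N))). ring.
Qed.

Lemma binet_0_0 : binet 0 0 = 1 - euler_gamma.
Proof.
  assert (H := is_lim_seq_binet 0 0 ltac:(lra)).
  unfold euler_gamma.
  rewrite <- Lim_seq_incr_1, <- Lim_seq_incr_1.
  rewrite (is_lim_seq_unique _ (1 - binet 0 0)); [simpl; ring|].
  apply is_lim_seq_ext with (fun N => 1 - sum_n (fun k => binet_term 0 k 0) N).
  - intros N. rewrite sum_binet_term_0. ring.
  - apply is_lim_seq_minus'; trivial. apply is_lim_seq_const.
Qed.

(** * Derivatives of all orders *)

Fixpoint n_derivable (D : R -> Prop) (n : nat) (f : R -> R) : Prop :=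
  match n with
  | O => True
  | S n => exists f', (forall x, D x -> is_derive f x (f' x)) /\ n_derivable D n f'
  end.

Lemma n_derivable_pred (D : R -> Prop) (n : nat) (f : R -> R) :
  n_derivable D (S n) f -> n_derivable D n f.
Proof.
  revert f. induction n as [|n IH]; intros f; [easy|].
  intros (f' & H & H'). exists f'. split; trivial. now apply IH.
Qed.

Lemma n_derivable_mult (D : R -> Prop) (n : nat) (f g : R -> R) :
  n_derivable D n f -> n_derivable D n g -> n_derivable D n (fun x => f x * g x).
Proof.
  assert (Hplus : forall n f g, n_derivable D n f -> n_derivable D n g ->
            n_derivable D n (fun x => f x + g x)).
  { clear. induction n as [|n IH]; intros f g; [easy|].
    intros (f' & Hf & Hf') (g' & Hg & Hg'). exists (fun x => f' x + g' x). split.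
    - intros x Hx. apply (is_derive_plus (V := R_NormedModule)); auto.
    - now apply IH. }
  revert f g. induction n as [|n IH]; intros f g; [easy|].
  intros Hf Hg. assert (Hf0 := n_derivable_pred _ _ _ Hf).
  assert (Hg0 := n_derivable_pred _ _ _ Hg).
  destruct Hf as (f' & Hf & Hf'). destruct Hg as (g' & Hg & Hg').
  exists (fun x => f' x * g x + f x * g' x). split.
  - intros x Hx. apply (is_derive_mult f g); auto. intros; apply Rmult_comm.
  - apply Hplus; now apply IH.
Qed.

Lemma n_derivable_exp (D : R -> Prop) (n : nat) (f : R -> R) :
  n_derivable D n f -> n_derivable D n (fun x => exp (f x)).
Proof.
  induction n as [|n IH]; [easy|].
  intros H. assert (H0 := IH (n_derivable_pred _ _ _ H)).
  destruct H as (f' & Hf & Hf'). exists (fun x => f' x * exp (f x)). split.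
  - intros x Hx. apply (is_derive_comp exp f); auto.
    apply is_derive_Reals, derivable_pt_lim_exp.
  - now apply n_derivable_mult.
Qed.

Lemma n_derivable_ex_derive_n (D : R -> Prop) (n : nat) (f : R -> R) (x : R) :
  open D -> n_derivable D n f -> D x -> ex_derive_n f n x.
Proof.
  intros HD. revert f. induction n as [|n IH]; intros f; [easy|].
  intros (f' & Hf & Hf') Hx. specialize (IH f' Hf' Hx).
  destruct n as [|n]; [exists (f' x); now apply Hf|].
  simpl in IH |- *.
  apply ex_derive_ext_loc with (2 := IH).
  apply filter_imp with (2 := HD x Hx). intros y Hy.
  transitivity (Derive_n (Derive f) n y).
  - apply Derive_n_ext_loc. apply filter_imp with (2 := HD y Hy).
    intros z Hz. symmetry. now apply is_derive_unique, Hf.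
  - change (Derive f) with (Derive_n f 1). rewrite Derive_n_comp, Nat.add_1_r. reflexivity.
Qed.

Lemma Derive_n_family (D : R -> Prop) (F : nat -> R -> R) (n : nat) (x : R) :
  open D -> (forall n x, D x -> is_derive (F n) x (F (S n) x)) ->
  D x -> Derive_n (F O) n x = F n x.
Proof.
  intros HD HF. revert x. induction n as [|n IH]; intros x Hx; [easy|].
  simpl. rewrite (Derive_ext_loc _ (F n)).
  - now apply is_derive_unique, HF.
  - apply filter_imp with (2 := HD x Hx). exact IH.
Qed.

Lemma n_derivable_family (D : R -> Prop) (F : nat -> R -> R) (m n : nat) :
  (forall n x, D x -> is_derive (F n) x (F (S n) x)) -> n_derivable D n (F m).
Proof.
  intros HF. revert m. induction n as [|n IH]; intros m; [easy|].
  exists (F (S m)). split; [apply HF | apply IH].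
Qed.

Definition log_ratio_derivative (alpha : R) (n : nat) (x : R) : R :=
  match n with
  | O => binet 0 x - 1 + (1 - alpha) * ln (x + 1)
  | S m => (-1) ^ n * (INR (fact n) * binet n x + (alpha - 1) * INR (fact m) * (/ (x + 1)) ^ n)
  end.

Lemma is_derive_log_ratio (alpha : R) (n : nat) (x : R) : -1 < x ->
  is_derive (log_ratio_derivative alpha n) x (log_ratio_derivative alpha (S n) x).
Proof.
  intros Hx. destruct n as [|m].
  - evar_last.
    + apply (is_derive_plus (V := R_NormedModule)).
      * apply (is_derive_minus (V := R_NormedModule)); [now apply is_derive_binet|].
        apply (is_derive_const (V := R_NormedModule)).
      * apply is_derive_scal. auto_derive; [lra | reflexivity].
    + unfold minus, plus, opp, zero; simpl. field. lra.
  - evar_last.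
    + unfold log_ratio_derivative. apply is_derive_scal.
      apply (is_derive_plus (V := R_NormedModule)).
      * apply is_derive_scal. now apply is_derive_binet.
      * apply is_derive_scal. apply is_derive_pow. auto_derive; [lra | reflexivity].
    + match goal with |- context [plus ?a ?b] => change (plus a b) with (a + b) end.
      unfold log_ratio_derivative.
      rewrite (fact_simpl (S m)), (fact_simpl m), !mult_INR.
      simpl pred. rewrite <- !tech_pow_Rmult. field. lra.
Qed.

Lemma ln_Gamma_ratio (alpha x : R) : -1 < x ->
  Gamma_root x / Rpower (x + 1) alpha = exp (log_ratio_derivative alpha 0 x).
Proof.
  intros Hx. unfold log_ratio_derivative, Rdiv, Rpower at 1. rewrite <- exp_Ropp.
  assert (E : Gamma_root x = exp (binet 0 x - 1 + ln (x + 1))).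
  { unfold Gamma_root. destruct (Req_EM_T x 0) as [->|H0].
    - rewrite binet_0_0, Rplus_0_l, ln_1. f_equal. ring.
    - unfold Rpower. f_equal.
      assert (H := binet_Gamma x Hx).
      apply Rmult_eq_reg_l with x; trivial.
      replace (x * (1 / x * ln (Gamma (x + 1)))) with (ln (Gamma (x + 1))) by (field; trivial).
      lra. }
  rewrite E, <- exp_plus. f_equal. ring.
Qed.

Theorem theorem2 (alpha : R) :
  log_completely_monotonic (Finite (-1)) p_infty
    (fun x : R => Gamma_root x / Rpower (x + 1) alpha)
  <-> alpha >= 1.
Proof.
  assert (HD : open (fun x => -1 < x)) by apply open_gt.
  assert (HF := fun n x Hx => is_derive_log_ratio alpha n x Hx).
  assert (Hext : forall x, -1 < x -> locally x (fun y =>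
            exp (log_ratio_derivative alpha 0 y) = Gamma_root y / Rpower (y + 1) alpha)).
  { intros x Hx. apply filter_imp with (2 := HD x Hx).
    intros y Hy. symmetry. now apply ln_Gamma_ratio. }
  assert (HDn : forall n x, -1 < x ->
    Derive_n (fun t => ln (Gamma_root t / Rpower (t + 1) alpha)) n x =
    log_ratio_derivative alpha n x).
  { intros n x Hx. rewrite <- (Derive_n_family _ _ n x HD HF Hx).
    apply Derive_n_ext_loc. apply filter_imp with (2 := Hext x Hx).
    intros y <-. apply ln_exp. }
  split.
  - intros (_ & _ & H). apply Rnot_lt_ge. intros Ha.
    set (g := log_ratio_derivative alpha 0).
    (* [g] would be decreasing, while it is at least [(1 - alpha) * ln (x + 1) - 1]. *)
    set (x := exp ((Rabs (g 0) + 2) / (1 - alpha)) - 1).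
    assert (Hx : 0 < x).
    { unfold x. rewrite <- exp_0 at 2. apply Rlt_0_minus, exp_increasing.
      apply Rdiv_lt_0_compat; generalize (Rabs_pos (g 0)); lra. }
    destruct (MVT_gen g 0 x (log_ratio_derivative alpha 1)) as (c & Hc & E).
    + intros t Ht. rewrite Rmin_left in Ht by lra. apply HF. lra.
    + intros t Ht. rewrite Rmin_left in Ht by lra.
      apply continuity_pt_filterlim.
      apply (ex_derive_continuous (V := R_NormedModule)). eexists. apply HF. lra.
    + rewrite Rmin_left in Hc by lra.
      assert (Hd := H 1%nat c (le_n _) ltac:(simpl; lra) I).
      rewrite HDn, pow_1 in Hd by lra.
      assert (log_ratio_derivative alpha 1 c * (x - 0) <= 0).
      { apply Rle_trans with (0 * (x - 0)); [apply Rmult_le_compat_r|]; lra. }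
      assert (Hb := binet_nonneg 0 x ltac:(lra)).
      assert (Hg : g x = binet 0 x - 1 + (Rabs (g 0) + 2)).
      { unfold g at 1, log_ratio_derivative, x at 2.
        replace (exp _ - 1 + 1) with (exp ((Rabs (g 0) + 2) / (1 - alpha))) by ring.
        rewrite ln_exp. field. lra. }
      generalize (Rle_abs (g 0)). lra.
  - intros Ha. repeat split.
    + intros x Hx _. simpl in Hx. rewrite ln_Gamma_ratio by easy. apply exp_pos.
    + intros n x Hx _. simpl in Hx.
      apply ex_derive_n_ext_loc with (1 := Hext x Hx).
      apply n_derivable_ex_derive_n with (fun x => -1 < x); trivial.
      apply n_derivable_exp. now apply n_derivable_family.
    + intros n x Hn Hx _. simpl in Hx. rewrite HDn by easy.
      destruct n as [|m]; [lia|]. unfold log_ratio_derivative.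
      rewrite <- Rmult_assoc, <- Rpow_mult_distr.
      replace (-1 * -1) with 1 by ring. rewrite pow1, Rmult_1_l.
      assert (0 <= / (x + 1)) by (apply Rlt_le, Rinv_0_lt_compat; lra).
      apply Rplus_le_le_0_compat.
      * apply Rmult_le_pos; [apply pos_INR | now apply binet_nonneg].
      * apply Rmult_le_pos; [|now apply pow_le].
        apply Rmult_le_pos; [lra | apply pos_INR].
Qed.
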